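(* Let the network graph be connected, let $\eta\ge 0$, and assume $\mathcal{H}=I_N\otimes R_u$ (i.e. $R_{u,1}=\dots=R_{u,N}=R_u$) with $R_u\in\mathbb{R}^{M\times M}$ symmetric positive-definite. Then the $(2N-1)M$ eigenvalues of the matrix $\mathcal{R}'$ (counted with multiplicity) are given by $\sigma\cup\tau$, where $$\sigma=\{\lambda_\ell(R_u):1\le \ell\le M\},$$ $$\tau=\Big\{\tfrac12\big(\lambda_\ell(R_u)+\eta\lambda_k(L)\big)\pm\tfrac12\sqrt{\big(\lambda_\ell(R_u)+\eta\lambda_k(L)\big)^2-4\lambda_k(L)}\;:\;1\le k\le N-1,\ 1\le \ell\le M\Big\},$$ with $\lambda_1(R_u),\dots,\lambda_M(R_u)$ the eigenvalues of $R_u$ and $\lambda_1(L)\ge\dots\ge\lambda_{N-1}(L)>\lambda_N(L)=0$ the eigenvalues of the Laplacian $L$ of the graph.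
   Context: Graph: $G$ is an undirected graph with nodes $1,\dots,N$ and $E$ edges (self-loops excluded). Its incidence matrix $C\in\mathbb{R}^{E\times N}$ has, in the row of edge $e$, entry $+1$ at the lower-indexed endpoint, $-1$ at the higher-indexed endpoint, and $0$ elsewhere. The Laplacian is $L=C^{T}C$. When $G$ is connected, $C$ has rank $N-1$. Fix a singular value decomposition $C=USV^{T}$ with $U\in\mathbb{R}^{E\times E}$, $V\in\mathbb{R}^{N\times N}$ orthogonal, $V=[\,V_2\ \ \tfrac{1}{\sqrt N}\mathbf 1_N]$, and $S\in\mathbb{R}^{E\times N}$ whose upper-left $(N-1)\times(N-1)$ block $S_2$ is diagonal with the nonzero singular values of $C$, all other entries of $S$ being zero. Put $\mathcal{S}_2=S_2\otimes I_M$, $\mathcal{V}_2=V_2\otimes I_M$, $\mathcal{V}_0=\tfrac{1}{\sqrt N}\mathbf 1_N\otimes I_M$. With $\mathcal{H}=\mathrm{blockdiag}\{R_{u,1},\dots,R_{u,N}\}$, $$\mathcal{R}'=\begin{bmatrix}\mathcal{V}_2^{T}\mathcal{H}\mathcal{V}_2+\eta\,\mathcal{S}_2^{T}\mathcal{S}_2 & \mathcal{V}_2^{T}\mathcal{H}\mathcal{V}_0 & \mathcal{S}_2^{T}\\ \mathcal{V}_0^{T}\mathcal{H}\mathcal{V}_2 & \frac1N\sum_{k=1}^N R_{u,k} & 0\\ -\mathcal{S}_2 & 0 & 0\end{bmatrix}\in\mathbb{R}^{(2N-1)M\times(2N-1)M}.$$ The union $\sigma\cup\tau$ is understood as a union of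 multisets (lists), with $M+2(N-1)M=(2N-1)M$ elements; square roots of negative numbers are complex. *)

(* Defs.v *)
From HB Require Import structures.
From mathcomp Require Import all_boot all_order all_algebra.
From mathcomp Require Import complex mxtens.

Set Implicit Arguments.
Unset Strict Implicit.
Unset Printing Implicit Defensive.

Import Order.TTheory GRing.Theory Num.Theory.
Local Open Scope ring_scope.
Local Open Scope complex_scope.

(* A simple undirected graph without self-loops on the nodes 'I_N, whose E edges
   are numbered arbitrarily; an edge is stored once, as the pair
   (lower-indexed endpoint, higher-indexed endpoint). *)
Record ugraph (N E : nat) := UGraph {
  edge : 'I_E -> 'I_N * 'I_N;
  edge_lt : forall e, ((edge e).1 < (edge e).2)%N;
  edge_inj : injective edge }.

Definition adj N E (G : ugraph N E) : rel 'I_N :=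
  [rel i j | [exists e, (edge G e == (i, j)) || (edge G e == (j, i))]].

Definition connected_graph N E (G : ugraph N E) : Prop :=
  forall i j, connect (adj G) i j.

Definition incidence (R : pzRingType) N E (G : ugraph N E) : 'M[R]_(E, N) :=
  \matrix_(e, i) ((i == (edge G e).1)%:R - (i == (edge G e).2)%:R).

Definition laplacian (R : pzRingType) N E (G : ugraph N E) : 'M[R]_N :=
  (incidence R G)^T *m incidence R G.

(* s lists the eigenvalues of A, repeated according to algebraic multiplicity
   (in any order); in particular char_poly A splits over K. *)
Definition eigenvalue_list (K : fieldType) n (A : 'M[K]_n) (s : seq K) : Prop :=
  char_poly A = \prod_(x <- s) ('X - x%:P).

Definition posdefmx (R : numDomainType) n (A : 'M[R]_n) : Prop :=
  A^T = A /\ forall x : 'cV[R]_n, x != 0 -> 0 < (x^T *m A *m x) 0 0.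

Definition orthogonal_mx (R : pzRingType) n (A : 'M[R]_n) : Prop :=
  A^T *m A = 1%:M.

(* The number of nodes is written n + 1 (not n.+1), so that V = [V2 v0] is a
   block row of square type; n plays the role of N - 1. *)

Definition unit_ones (R : rcfType) n : 'cV[R]_(n + 1) :=
  const_mx (Num.sqrt (n + 1)%:R)^-1.

(* The E x (n + 1) matrix with upper-left n x n block S2 and zeros elsewhere. *)
Definition pad_mx (R : pzRingType) E n (S2 : 'M[R]_n) : 'M[R]_(E, n + 1) :=
  (pid_mx n : 'M_(E, n)) *m S2 *m (pid_mx n : 'M_(n, n + 1)).

Record incidence_svd (R : rcfType) n E (C : 'M[R]_(E, n + 1))
    (U : 'M[R]_E) (S2 : 'M[R]_n) (V2 : 'M[R]_(n + 1, n)) : Prop := IncidenceSVD {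
  svd_U : orthogonal_mx U;
  svd_V : orthogonal_mx (row_mx V2 (unit_ones R n));
  svd_diag : is_diag_mx S2;
  svd_pos : forall k, 0 < S2 k k;
  svd_eq : C = U *m pad_mx E S2 *m (row_mx V2 (unit_ones R n))^T }.

Lemma sum_const_dim N M : (\sum_(k < N) M = N * M)%N.
Proof. by rewrite sum_nat_const card_ord. Qed.

Definition blockdiag (R : pzRingType) N M (Rk : 'I_N -> 'M[R]_M) : 'M[R]_(N * M) :=
  castmx (sum_const_dim N M, sum_const_dim N M) (\mxdiag_(k < N) Rk k).

Section Rprime.
Variables (R : rcfType) (n M : nat) (eta : R).
Variables (Rk : 'I_(n + 1) -> 'M[R]_M) (S2 : 'M[R]_n) (V2 : 'M[R]_(n + 1, n)).

Let H : 'M_((n + 1) * M) := blockdiag Rk.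
Let cS2 : 'M_(n * M) := S2 *t 1%:M.
Let cV2 : 'M_((n + 1) * M, n * M) := V2 *t 1%:M.
Let cV0 : 'M_((n + 1) * M, M) :=
  castmx (erefl, mul1n M) (unit_ones R n *t 1%:M).

Definition Rprime : 'M[R]_(n * M + (M + n * M)) :=
  col_mx (row_mx (cV2^T *m H *m cV2 + eta *: (cS2^T *m cS2))
                 (row_mx (cV2^T *m H *m cV0) cS2^T))
  (col_mx (row_mx (cV0^T *m H *m cV2)
                 (row_mx ((n + 1)%:R^-1 *: \sum_k Rk k) 0))
          (row_mx (- cS2) (row_mx 0 0))).

End Rprime.

Definition sigma_list (R : rcfType) M (lam : 'I_M -> R) : seq R[i] :=
  [seq (lam l)%:C | l <- enum 'I_M].

(* Only mu_0, ..., mu_(n-1) are used.  [sqrtC] is a complex square root; which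
   of the two it picks is immaterial, as both signs are listed. *)
Definition tau_list (R : rcfType) n M (eta : R) (lam : 'I_M -> R)
    (mu : 'I_(n + 1) -> R) : seq R[i] :=
  let b (k : 'I_n) (l : 'I_M) := lam l + eta * mu (lshift 1 k) in
  let d (k : 'I_n) (l : 'I_M) : R[i] :=
    sqrtC (b k l ^+ 2 - 4 * mu (lshift 1 k))%:C in
  [seq 2^-1 * (b k l)%:C + 2^-1 * d k l | k <- enum 'I_n, l <- enum 'I_M] ++
  [seq 2^-1 * (b k l)%:C - 2^-1 * d k l | k <- enum 'I_n, l <- enum 'I_M].

(* Main.v *)
(* Since [V2 v0] is orthogonal, H = 1 (x) Ru makes the off-diagonal blocks
   V2^T H v0 of R' vanish, so R' splits into Ru and the saddle-point matrix
   [[1 (x) Ru + eta D (x) 1, S2^T (x) 1], [- S2 (x) 1, 0]] with D = S2^T S2.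
   Its lower blocks commute, so its characteristic polynomial is
     det (X (X - 1 (x) Ru - eta D (x) 1) + D (x) 1)
       = prod_k det ((X^2 - eta d_k X + d_k) - X Ru)
       = prod_(k, l) (X^2 - (lam_l + eta d_k) X + d_k),
   and the d_k are the eigenvalues of L other than the 0 carried by v0. *)
Require Import Defs.
From HB Require Import structures.
From mathcomp Require Import all_boot all_order all_algebra.
From mathcomp Require Import complex mxtens ring.

Set Implicit Arguments.
Unset Strict Implicit.
Unset Printing Implicit Defensive.

Import Order.TTheory GRing.Theory Num.Theory.
Local Open Scope ring_scope.
Local Open Scope complex_scope.

(** * Characteristic polynomial of a saddle-point matrix *)

Lemma char_poly_saddle (R : idomainType) m p (P Q S : 'M[R]_m) (T : 'M[R]_p) :
  char_poly (block_mx P (row_mx 0 Q) (col_mx 0 S) (block_mx T 0 0 0)) =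
  char_poly T * \det ('X *: char_poly_mx P - map_mx polyC (Q *m S)).
Proof.
(* Eliminate the lower left block with a column operation of determinant 'X^m. *)
apply: (@mulIf _ ('X ^+ m)); first by rewrite expf_neq0 ?polyX_eq0.
set Sp := map_mx polyC S.
have detW : \det (block_mx 'X%:M 0 (col_mx (0 : 'M_(p, m)) Sp) 1%:M) = 'X ^+ m :> {poly R}
  by rewrite det_lblock det1 mulr1 det_scalar.
rewrite -{1}detW -mulrA [RHS]mulrCA /char_poly -det_mulmx.
suff -> : char_poly_mx (block_mx P (row_mx 0 Q) (col_mx 0 S) (block_mx T 0 0 0))
    *m block_mx 'X%:M 0 (col_mx 0 Sp) 1%:M =
  block_mx ('X *: char_poly_mx P - map_mx polyC (Q *m S))
           (row_mx 0 (- map_mx polyC Q)) 0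
           (block_mx (char_poly_mx T) 0 0 'X%:M).
  by rewrite !det_ublock det_scalar.
rewrite /char_poly_mx !map_block_mx /= map_row_mx map_col_mx !map_mx0 map_mxM /=.
rewrite !(scalar_mx_block _ _ 'X) !opp_block_mx !add_block_mx !subr0 ?sub0r ?oppr0 ?add0r.
rewrite mulmx_block !mulmx0 !mulmx1 !add0r.
rewrite opp_row_mx oppr0 mul_row_col mulmx0 add0r mulNmx mul_mx_scalar.
congr block_mx.
rewrite mul_mx_scalar mul_block_col !mulmx0 !mul0mx !addr0 add0r mul_scalar_mx.
by rewrite opp_col_mx scale_col_mx oppr0 scaler0 scalerN add_col_mx addr0 addNr col_mx0.
Qed.

(** * Block-diagonal matrices and their determinants *)

(* Same matrix as [blockdiag], but without the cast of dimensions: as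
   n.+1 * M is convertible to M + n * M, splitting off the first block needs no
   cast either. *)
Definition diagblock (R : pzRingType) n M (F : 'I_n -> 'M[R]_M) : 'M[R]_(n * M) :=
  \matrix_(i, j) (let: (k, l) := mxtens_unindex i in
                  let: (k', l') := mxtens_unindex j in
                  F k l l' *+ (k == k')).

Lemma diagblockE (R : pzRingType) n M (F : 'I_n -> 'M[R]_M) k l k' l' :
  diagblock F (mxtens_index (k, l)) (mxtens_index (k', l')) = F k l l' *+ (k == k').
Proof. by rewrite mxE !mxtens_indexK. Qed.

Lemma mxtens_index0 n M (l : 'I_M) :
  mxtens_index (0 : 'I_n.+1, l) = lshift (n * M) l.
Proof. exact: val_inj. Qed.

Lemma mxtens_index_lift n M (k : 'I_n) (l : 'I_M) :
  mxtens_index (lift 0 k : 'I_n.+1, l) = rshift M (mxtens_index (k, l)).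
Proof. by apply: val_inj; rewrite /= /bump leq0n mulSn addnA. Qed.

Lemma diagblock_recl (R : pzRingType) n M (F : 'I_n.+1 -> 'M[R]_M) :
  diagblock F =
  block_mx (F 0) 0 0 (diagblock (fun k => F (lift 0 k))) :> 'M_(M + n * M).
Proof.
apply/matrixP => i j.
case: (@mxtens_indexP n.+1 M i) => k l {i}; case: (@mxtens_indexP n.+1 M j) => k' l' {j}.
rewrite [LHS](@diagblockE _ n.+1 M).
case: (unliftP 0 k) => [k1|] ->; case: (unliftP 0 k') => [k1'|] ->.
- by rewrite !mxtens_index_lift block_mxEdr diagblockE (inj_eq lift_inj).
- by rewrite mxtens_index_lift mxtens_index0 block_mxEdl mxE.
- by rewrite mxtens_index_lift mxtens_index0 block_mxEur mxE.
- by rewrite !mxtens_index0 block_mxEul.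
Qed.

Lemma det_diagblock (R : comPzRingType) n M (F : 'I_n -> 'M[R]_M) :
  \det (diagblock F) = \prod_k \det (F k).
Proof.
elim: n F => [|n IHn] F; first by rewrite big_ord0 det_mx00.
by rewrite diagblock_recl (@det_ublock _ M (n * M)) IHn big_ord_recl.
Qed.

(** * Determinants of linear pencils *)

(** Factoring out [b] leaves the characteristic polynomial of [A] evaluated at [a / b]. Its degree
    forces [size s = n], so [b ^+ n] supplies one [b] per factor. *)
Lemma det_pencil_field (F : fieldType) n (A : 'M[F]_n) (s : seq F) (a b : F) :
  b != 0 -> char_poly A = \prod_(x <- s) ('X - x%:P) ->
  \det (a%:M - b *: A) = \prod_(x <- s) (a - b * x).
Proof.
move=> b0 hA.
have -> : a%:M - b *: A = b *: map_mx (horner_eval (a / b)) (char_poly_mx A).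
  apply/matrixP => i j; rewrite !mxE /horner_eval hornerD hornerN.
  rewrite hornerMn hornerX hornerC.
  by rewrite mulrBr mulrnAr mulrCA divff ?mulr1.
rewrite detZ det_map_mx -/(char_poly A) hA /= /horner_eval horner_prod.
have sz : size s = n.
  by apply: succn_inj; rewrite -(size_char_poly A) hA size_prod_XsubC.
rewrite -{1}sz -[size s]count_predT -iter_mulr_1 -big_const_seq -big_split /=.
by apply: eq_bigr => x _; rewrite hornerXsubC mulrBr mulrCA divff ?mulr1.
Qed.

(** Embedding in the fraction field makes [b] invertible. The intended ring is a polynomial ring,
    with [b = 'X]. *)
Lemma det_pencil (R : idomainType) n (A : 'M[R]_n) (s : seq R) (a b : R) :
  b != 0 -> char_poly A = \prod_(x <- s) ('X - x%:P) ->
  \det (a%:M - b *: A) = \prod_(x <- s) (a - b * x).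
Proof.
move=> b0 hA; apply/eqP; rewrite -tofrac_eq -det_map_mx; apply/eqP.
rewrite map_mxB map_scalar_mx map_mxZ /= (@det_pencil_field _ _ _ (map (@tofrac R) s)).
- by rewrite big_map rmorph_prod; apply: eq_bigr => x _; rewrite /= rmorphB rmorphM.
- by rewrite tofrac_eq0.
rewrite -map_char_poly hA rmorph_prod big_map; apply: eq_bigr => x _.
by rewrite rmorphB /= map_polyX map_polyC.
Qed.

(** * Block and spectral tools for orthogonal decompositions *)

Lemma blockdiag_diagblock (R : pzRingType) n M (F : 'I_n -> 'M[R]_M) :
  blockdiag F = diagblock F.
Proof.
(* Both numberings send the pair (k, l) to position k * M + l. *)
have Rk (k : 'I_n) (l : 'I_M) :
    cast_ord (esym (sum_const_dim n M)) (mxtens_index (k, l)) = tagnat.Rank k l.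
  apply: ord_inj; rewrite tagnat.RankEsum /=; congr (_ + _)%N.
  rewrite -(big_ord_widen n (fun=> M)) ?(ltnW (ltn_ord k)) //.
  by rewrite sum_nat_const card_ord.
apply/matrixP => i j; case: (mxtens_indexP i) => k l {i}.
case: (mxtens_indexP j) => k' l' {j}.
rewrite diagblockE /blockdiag castmxE /= !Rk.
(* This function is [mxdiag F] written as a general block matrix, whose block (k, k') can be
   extracted. *)
have := mxblockK (fun i j : 'I_n => if i == j then conform_mx 0 (F i) else 0 : 'M_M) k k'.
move=> /matrixP/(_ l l'); rewrite -/(mxdiag F) !mxE => ->.
by case: eqP => _; rewrite ?conform_mx_id ?mxE.
Qed.

Lemma char_poly_orthogonal_conj (R : comNzRingType) n (V A : 'M[R]_n) :
  orthogonal_mx V -> char_poly (V *m A *m V^T) = char_poly A.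
Proof.
move=> VV; have VV' : V *m V^T = 1%:M by exact: mulmx1C.
have -> : char_poly (V *m A *m V^T) =
    \det (map_mx polyC V *m char_poly_mx A *m map_mx polyC V^T).
  congr (\det _); rewrite /char_poly_mx mulmxBr mulmxBl -!map_mxM mul_mx_scalar.
  by rewrite -scalemxAl -map_mxM VV' map_mx1 scalemx1.
by rewrite !det_mulmx mulrAC -det_mulmx -map_mxM VV' map_mx1 det1 mul1r.
Qed.

Lemma diag_mx_gram (R : pzRingType) n (S : 'M[R]_n) k k' :
  is_diag_mx S -> (S^T *m S) k k' = S k k ^+ 2 *+ (k == k').
Proof.
move=> /is_diag_mxP Sd; rewrite mxE (bigD1 k) //= big1 => [|j jk].
  rewrite mxE addr0; case: eqP => [<-|/eqP kk']; first by rewrite expr2.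
  by rewrite (Sd _ _ kk') mulr0.
by rewrite mxE Sd ?mul0r.
Qed.

Lemma char_poly_gram (R : comNzRingType) n (S : 'M[R]_n) :
  is_diag_mx S -> char_poly (S^T *m S) = \prod_k ('X - (S k k ^+ 2)%:P).
Proof.
move=> Sd; rewrite char_poly_trig.
  by apply: eq_bigr => k _; rewrite diag_mx_gram // eqxx.
apply: is_diag_mx_is_trig; apply/is_diag_mxP => i j ij.
by rewrite diag_mx_gram // -val_eqE (negPf ij).
Qed.

Lemma orthogonal_row_mx (R : comPzRingType) m n p (A : 'M[R]_(m, n)) (B : 'M[R]_(m, p)) :
  (row_mx A B)^T *m row_mx A B = 1%:M ->
  [/\ A^T *m A = 1%:M, A^T *m B = 0, B^T *m A = 0 & B^T *m B = 1%:M].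
Proof. by rewrite tr_row_mx mul_col_row scalar_mx_block => /eq_block_mx[]. Qed.

(** * Connectivity, the incidence SVD and the Laplacian spectrum *)

(** Row e of C w is the difference of w at the two ends of e, so w agrees across each edge and hence
    along paths. *)
Lemma incidence_ker_const (R : pzRingType) N E (G : ugraph N E) (w : 'cV[R]_N) :
  connected_graph G -> incidence R G *m w = 0 -> forall i j, w i 0 = w j 0.
Proof.
move=> hG Cw i j.
have edge_eq e : w (edge G e).1 0 = w (edge G e).2 0.
  apply/eqP; rewrite -subr_eq0; have /matrixP/(_ e 0) := Cw; rewrite !mxE => <-.
  under eq_bigr do rewrite mxE mulrBl.
  have sum_delta k : \sum_j (j == k)%:R * w j 0 = w k 0.
    by rewrite (bigD1 k) //= eqxx mul1r big1 ?addr0 // => ? /negPf ->; rewrite mul0r.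
  by rewrite sumrB !sum_delta.
have /connectP[p pth ->] := hG i j.
elim: p i pth => //= k p IHp i /andP[/existsP[e ike] /IHp <-].
by case/orP: ike => /eqP eE; have := edge_eq e; rewrite eE.
Qed.

Lemma pid_mx_rV (R : pzRingType) n p : (pid_mx n : 'M[R]_(n, n + p)) = row_mx 1%:M 0.
Proof.
apply/matrixP => i j; rewrite !mxE; case: (splitP j) => k ->; rewrite !mxE.
  by rewrite ltn_ord andbT.
by rewrite ltn_eqF // ltn_addr.
Qed.

Section IncidenceSVD.
Variables (R : rcfType) (n E : nat) (G : ugraph (n + 1) E).
Variables (U : 'M[R]_E) (S2 : 'M[R]_n) (V2 : 'M[R]_(n + 1, n)).
Hypotheses (hG : connected_graph G) (hsvd : incidence_svd (incidence R G) U S2 V2).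

(* Without this, [pad_mx] would truncate S2. If E < n, the column of V2 of index
   E is in the kernel of C, hence constant, yet it is orthogonal to v0. *)
Lemma connected_leq_edges : (n <= E)%N.
Proof.
rewrite leqNgt; apply/negP => ltEn.
have [VV _ VU _] := orthogonal_row_mx (svd_V hsvd).
pose w := col (Ordinal ltEn) V2.
have Cw : incidence R G *m w = 0.
  rewrite (svd_eq hsvd) -!mulmxA.
  have -> : (row_mx V2 (unit_ones R n))^T *m w = col_mx (delta_mx (Ordinal ltEn) 0) 0.
    by rewrite tr_row_mx mul_col_mx /w !colE !mulmxA VV VU mul0mx mul1mx.
  rewrite /pad_mx pid_mx_rV mul_row_col mulmx0 addr0 mul1mx -colE.
  apply/matrixP => i j; rewrite !mxE big1 // => e _; rewrite !mxE.
  rewrite big1 ?mulr0 // => k _; rewrite !mxE.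
  (* Off the index E, diagonality of [S2] gives 0. At E, the row index of [pid_mx] is below E, so
     its entry is 0. *)
  case: (eqVneq k (Ordinal ltEn)) => [->|kE]; last first.
    by rewrite (is_diag_mxP (svd_diag hsvd)) ?mulr0.
  by rewrite /= ltn_eqF ?mul0r.
have wc := incidence_ker_const hG Cw.
have w0 : w = 0.
  have n1 : (0 < n + 1)%N by rewrite addn1.
  (* As w is constant, its inner product with v0 is (n + 1) / sqrt (n + 1) times that constant. *)
  have /matrixP/(_ 0 (Ordinal ltEn)) := VU; rewrite !mxE.
  under eq_bigr => i _.
    rewrite !mxE; have -> : V2 i (Ordinal ltEn) = w (rshift n 0) 0.
      by rewrite -(wc i) mxE.
    over.
  rewrite sumr_const card_ord -mulrnAl => /eqP.
  rewrite mulf_eq0 mulrn_eq0 (gtn_eqF n1) /=.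
  rewrite invr_eq0 sqrtr_eq0 lern0 (gtn_eqF n1) /= => /eqP wn.
  by apply/matrixP => i j; rewrite ord1 (wc i (rshift n 0)) wn mxE.
have : V2^T *m w = delta_mx (Ordinal ltEn) 0 by rewrite /w colE mulmxA VV mul1mx.
move=> /matrixP/(_ (Ordinal ltEn) 0)/eqP.
by rewrite w0 mulmx0 !mxE !eqxx eq_sym oner_eq0.
Qed.

(** In C^T C the factor [U] cancels, leaving the conjugate by V of diag(S2^T S2, 0). The factor ['X]
    is the eigenvalue 0 of v0. *)
Lemma char_poly_laplacian :
  char_poly (laplacian R G) = (\prod_k ('X - (S2 k k ^+ 2)%:P)) * 'X.
Proof.
rewrite /laplacian (svd_eq hsvd); set V := row_mx _ _; set P := pad_mx _ _.
have -> : (U *m P *m V^T)^T *m (U *m P *m V^T) = V *m (P^T *m P) *m V^T.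
  by rewrite !trmx_mul trmxK !mulmxA -(mulmxA _ U^T U) (svd_U hsvd) mulmx1.
rewrite (char_poly_orthogonal_conj _ (svd_V hsvd)).
have -> : P^T *m P = block_mx (S2^T *m S2) 0 0 (0 : 'M_1).
  (* This product has rank min(n, E), which connectedness makes equal to n. *)
  have pidK : (pid_mx n : 'M[R]_(n, E)) *m (pid_mx n : 'M_(E, n)) = 1%:M.
    by rewrite mul_pid_mx minnn (minn_idPr connected_leq_edges) pid_mx_1.
  rewrite /P /pad_mx !trmx_mul !mulmxA !tr_pid_mx -[_ *m pid_mx n *m pid_mx n]mulmxA pidK.
  have -> : (pid_mx n : 'M[R]_(n + 1, n)) = col_mx 1%:M 0.
    by rewrite -tr_pid_mx pid_mx_rV tr_row_mx trmx1 trmx0.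
  rewrite mulmx1 pid_mx_rV 2!mul_col_mx !mul1mx !mul0mx mul_col_row.
  by rewrite !mulmx0 mulmx1 !mul0mx.
rewrite /char_poly char_block_diag_mx det_ublock -/(char_poly _).
rewrite char_poly_gram ?(svd_diag hsvd) //.
by rewrite -/(char_poly _) char_poly_trig ?mx0_is_trig // big_ord1 mxE subr0.
Qed.

(** The full spectrum consists of the squared singular values and 0. The last entry of [mu] is the
    least, and all entries are squares or 0, so it is the 0 to be cancelled. *)
Lemma laplacian_spectrum_perm (mu : 'I_(n + 1) -> R) :
  eigenvalue_list (laplacian R G) [seq mu k | k <- enum 'I_(n + 1)] ->
  (forall i j : 'I_(n + 1), (i <= j)%N -> mu j <= mu i) ->
  perm_eq [seq mu (lshift 1 k) | k <- enum 'I_n] [seq S2 k k ^+ 2 | k <- enum 'I_n].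
Proof.
move=> hmu mu_sorted.
have enumS : [seq mu k | k <- enum 'I_(n + 1)] =
    rcons [seq mu (lshift 1 k) | k <- enum 'I_n] (mu (rshift n 0)).
  rewrite (_ : enum 'I_(n + 1) = rcons [seq lshift 1 k | k <- enum 'I_n] (rshift n 0)).
    by rewrite map_rcons -map_comp.
  apply: (inj_map (@ord_inj (n + 1))); rewrite map_rcons -map_comp.
  transitivity (iota 0 (n + 1)); first exact: val_enum_ord.
  by rewrite iotaD -(val_enum_ord n) cats1 /= addn0.
have p0 : perm_eq [seq mu k | k <- enum 'I_(n + 1)]
    (rcons [seq S2 k k ^+ 2 | k <- enum 'I_n] 0).
  apply: prod_XsubC_eq; rewrite -hmu char_poly_laplacian -cats1 big_cat big_seq1 subr0.
  by rewrite big_map big_enum.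
have mu0 : mu (rshift n 0) = 0.
  apply: le_anti; apply/andP; split.
    have /mapP[k _ ->] : 0 \in [seq mu k | k <- enum 'I_(n + 1)].
      by rewrite (perm_mem p0) mem_rcons inE eqxx.
    by apply: mu_sorted; rewrite /= addn0 -ltnS -[n.+1]addn1.
  have : mu (rshift n 0) \in [seq mu k | k <- enum 'I_(n + 1)].
    by rewrite map_f ?mem_enum.
  rewrite (perm_mem p0) mem_rcons inE => /predU1P[-> //|/mapP[k _ ->]].
  exact: sqr_ge0.
by move: p0; rewrite enumS mu0 -!cats1 perm_cat2r.
Qed.

(** * Block form and characteristic polynomial of R' *)

Lemma Rprime_block M eta (Rk : 'I_(n + 1) -> 'M[R]_M) Ru :
  blockdiag Rk = (1%:M : 'M[R]_(n + 1)) *t Ru ->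
  Rprime eta Rk S2 V2 =
  block_mx (1%:M *t Ru + eta *: ((S2^T *m S2) *t 1%:M)) (row_mx 0 (S2^T *t 1%:M))
           (col_mx 0 (- (S2 *t 1%:M))) (block_mx Ru 0 0 0).
Proof.
move=> hH.
have [VV Vu _ _] := orthogonal_row_mx (svd_V hsvd).
have RkE k : Rk k = Ru.
  apply/matrixP => l l'.
  move/matrixP/(_ (mxtens_index (k, l)) (mxtens_index (k, l'))): hH.
  by rewrite blockdiag_diagblock diagblockE eqxx tensmxE mxE eqxx mul1r.
rewrite /Rprime hH !trmx_tens !trmx1; set c := castmx _ _.
(* Stated for every [A]: the opposite block follows by transposition, with [Ru^T] in place of
   [Ru]. *)
have Vc (A : 'M_M) : V2^T *t 1%:M *m (1%:M *t A) *m c = 0.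
  have -> : V2^T *t 1%:M *m (1%:M *t A) *m c =
      castmx (erefl, mul1n M) (V2^T *t 1%:M *m (1%:M *t A) *m (unit_ones R n *t 1%:M)).
    by rewrite castmx_mul castmx_id.
  rewrite !tensmx_mul mulmx1 Vu tens0mx.
  by apply/matrixP => i j; rewrite castmxE !mxE.
have cV : c^T *m (1%:M *t Ru) *m (V2 *t 1%:M) = 0.
  apply: trmx_inj; rewrite trmx0 !trmx_mul trmxK !trmx_tens !trmx1 mulmxA.
  exact: Vc.
have -> : (n + 1)%:R^-1 *: \sum_k Rk k = Ru.
  rewrite (eq_bigr _ (fun k _ => RkE k)) sumr_const card_ord -scaler_nat.
  rewrite scalerA mulVf ?scale1r //.
  by rewrite pnatr_eq0 addn1.
rewrite Vc cV !tensmx_mul !mulmx1 VV mul1mx.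
rewrite [RHS]block_mxEv; congr col_mx.
by rewrite -block_mxEh block_mxEv.
Qed.

End IncidenceSVD.

Lemma char_poly_Rprime (R : rcfType) (n E M : nat) (G : ugraph (n + 1) E)
    (U : 'M[R]_E) (S2 : 'M[R]_n) (V2 : 'M[R]_(n + 1, n))
    (eta : R) (Rk : 'I_(n + 1) -> 'M[R]_M) (Ru : 'M[R]_M) (s : seq R) :
  incidence_svd (incidence R G) U S2 V2 ->
  blockdiag Rk = (1%:M : 'M[R]_(n + 1)) *t Ru ->
  eigenvalue_list Ru s ->
  char_poly (Rprime eta Rk S2 V2) =
  (\prod_(x <- s) ('X - x%:P)) *
  \prod_(d <- [seq S2 k k ^+ 2 | k <- enum 'I_n])
     \prod_(x <- s) ('X ^+ 2 - (x + eta * d)%:P * 'X + d%:P).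
Proof.
move=> hsvd hH hs; rewrite (Rprime_block hsvd eta hH) char_poly_saddle hs.
congr (_ * _); rewrite big_map big_enum /=.
(* [p k] collects the scalar terms of X (X - Ru - eta d_k) + d_k; what remains is - X Ru. *)
pose p k : {poly R} := 'X ^+ 2 - (eta * S2 k k ^+ 2)%:P * 'X + (S2 k k ^+ 2)%:P.
have -> : 'X *: char_poly_mx (1%:M *t Ru + eta *: (S2^T *m S2 *t 1%:M))
    - map_mx polyC (S2^T *t 1%:M *m - (S2 *t 1%:M)) =
  diagblock (fun k => (p k)%:M - 'X *: map_mx polyC Ru).
  apply/matrixP => i j; case: (mxtens_indexP i) => k l {i}.
  case: (mxtens_indexP j) => k' l' {j}.
  rewrite diagblockE mulmxN tensmx_mul mulmx1 !mxE !mxtens_indexK /=.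
  have gramE : \sum_j S2^T k j * S2 j k' = S2 k k ^+ 2 *+ (k == k').
    by rewrite -(diag_mx_gram k k' (svd_diag hsvd)) mxE.
  rewrite gramE (inj_eq (can_inj (@mxtens_indexK _ _))) xpair_eqE /p.
  case: (k == k'); case: (l == l'); rewrite /= ?mulr1n ?mulr0n; ring.
rewrite det_diagblock; apply: eq_bigr => k _.
(* The pencil lives over [{poly R}], with the eigenvalues of [Ru] as constant polynomials. *)
rewrite (@det_pencil _ _ _ (map polyC s)) ?polyX_eq0 //; last first.
  by rewrite -map_char_poly hs rmorph_prod big_map; apply: eq_bigr => x _;
    rewrite rmorphB /= map_polyX map_polyC.
by rewrite big_map; apply: eq_bigr => x _; rewrite /p !polyCD; ring.
Qed.

(** By Vieta: the roots have sum b and product (b^2 - d^2) / 4 = c. *)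
Lemma quadratic_factor (R : rcfType) (b c : R) :
  let d : R[i] := sqrtC (b ^+ 2 - 4 * c)%:C in
  map_poly (real_complex R) ('X ^+ 2 - b%:P * 'X + c%:P) =
  ('X - (2^-1 * b%:C + 2^-1 * d)%:P) * ('X - (2^-1 * b%:C - 2^-1 * d)%:P).
Proof.
move=> d; rewrite rmorphD rmorphB rmorphXn rmorphM /= map_polyX !map_polyC /=.
have dd : d ^+ 2 = b%:C ^+ 2 - 4 * c%:C.
  by rewrite sqrtCK rmorphB rmorphXn rmorphM rmorph_nat.
set x := _ + _ * d; set y := _ - _ * d.
have -> : b%:C = x + y by rewrite /x /y; field.
have -> : c%:C = x * y.
  have -> : x * y = 4^-1 * (b%:C ^+ 2 - d ^+ 2) by rewrite /x /y; field.
  by rewrite dd; field.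
by rewrite polyCD polyCM; ring.
Qed.

Theorem theorem4 (R : rcfType) (n E M : nat) (G : ugraph (n + 1) E)
    (hG : connected_graph G)
    (U : 'M[R]_E) (S2 : 'M[R]_n) (V2 : 'M[R]_(n + 1, n))
    (hsvd : incidence_svd (incidence R G) U S2 V2)
    (eta : R) (heta : 0 <= eta)
    (Rk : 'I_(n + 1) -> 'M[R]_M) (Ru : 'M[R]_M)
    (hRu : posdefmx Ru)
    (hH : blockdiag Rk = (1%:M : 'M[R]_(n + 1)) *t Ru)
    (lam : 'I_M -> R)
    (hlam : eigenvalue_list Ru [seq lam l | l <- enum 'I_M])
    (mu : 'I_(n + 1) -> R)
    (hmu : eigenvalue_list (laplacian R G) [seq mu k | k <- enum 'I_(n + 1)])
    (hmu_sorted : forall i j : 'I_(n + 1), (i <= j)%N -> mu j <= mu i) :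
  eigenvalue_list
    (map_mx (real_complex R) (Rprime eta Rk S2 V2))
    (sigma_list lam ++ tau_list eta lam mu).
Proof.
rewrite /eigenvalue_list -map_char_poly (char_poly_Rprime eta hsvd hH hlam).
(* Trade the squared singular values for the first n Laplacian eigenvalues. *)
rewrite -(perm_big _ (laplacian_spectrum_perm hG hsvd hmu hmu_sorted)) /=.
rewrite rmorphM !rmorph_prod /= /sigma_list /tau_list !big_cat /= !big_map.
congr (_ * _).
  by apply: eq_bigr => l _; rewrite rmorphB /= map_polyX map_polyC.
(* The plus and minus lists are merged so that each (k, l) contributes its conjugate pair of linear
   factors. *)
rewrite !big_allpairs_dep /= -big_split /= [RHS]big_enum /=.
apply: eq_bigr => k _; rewrite rmorph_prod big_map -big_split /=.
apply: eq_bigr => l _.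
exact: quadratic_factor.
Qed.
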